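(* Let $p,q$ be primes with $p\equiv 1\pmod q$ and $q>2$, and let $g$ be a fixed element of order $q$ in $\mathbb{Z}_p^\times$. Up to isomorphism, there is a unique left brace with additive group isomorphic to $\mathbb{Z}_p^2\times\mathbb{Z}_q$ and with $|\ker\lambda|=p$. It is $(B,+,\circ)$ with $B=\mathbb{Z}_p\times\mathbb{Z}_p\times\mathbb{Z}_q$ and $$\begin{pmatrix} x_1\\ x_2\\ x_3\end{pmatrix}+\begin{pmatrix} y_1\\ y_2\\ y_3\end{pmatrix}=\begin{pmatrix} x_1+y_1\\ x_2+y_2\\ x_3+y_3\end{pmatrix},\qquad \begin{pmatrix} x_1\\ x_2\\ x_3\end{pmatrix}\circ\begin{pmatrix} y_1\\ y_2\\ y_3\end{pmatrix}=\begin{pmatrix} x_1+g^{x_3}y_1+g^{2^{-1}x_3}x_2y_2\\ x_2+g^{2^{-1}x_3}y_2\\ x_3+y_3\end{pmatrix}$$ for all $x_1,x_2,y_1,y_2\in\mathbb{Z}_p$ and $x_3,y_3\in\mathbb{Z}_q$, where $2^{-1}$ is the inverse of $2$ in $\mathbb{Z}_q$. In particular, $(B,\circ)\cong\mathcal{G}_2$.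
   Context: A skew (left) brace is a triple $(B,+,\circ)$ where $(B,+)$ and $(B,\circ)$ are groups such that $a\circ(b+c)=a\circ b-a+a\circ c$ for all $a,b,c\in B$; it is a left brace if $(B,+)$ is abelian. The map $\lambda:(B,\circ)\to\mathrm{Aut}(B,+)$, $\lambda_a(b)=-a+a\circ b$, is a group homomorphism, with kernel $\ker\lambda$. Isomorphisms are bijections preserving both operations. For $k\in\mathbb{Z}_q$, $\mathcal{G}_k=\langle\sigma,\tau,\epsilon\mid\sigma^p=\tau^p=\epsilon^q=1,\ [\sigma,\tau]=1,\ \epsilon\sigma\epsilon^{-1}=\sigma^g,\ \epsilon\tau\epsilon^{-1}=\tau^{g^k}\rangle\cong\mathbb{Z}_p^2\rtimes\mathbb{Z}_q$. *)

(* Defs.v *)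
From HB Require Import structures.
From mathcomp Require Import all_boot all_order all_algebra.
From mathcomp Require Import all_fingroup all_solvable.

Set Implicit Arguments.
Unset Strict Implicit.
Unset Printing Implicit Defensive.

Import GRing.Theory.
Local Open Scope ring_scope.

(* Makes a product of finZmodTypes a finZmodType. *)
HB.saturate prod.

Definition is_group (T : Type) (op : T -> T -> T) : Prop :=
  associative op /\
  exists e : T, [/\ left_id e op, right_id e op &
    forall x : T, exists y : T, op y x = e /\ op x y = e].

(* A left brace is a skew brace whose additive group is abelian: (B, +) is the
   group underlying the zmodType B, and only the second operation is explicit. *)
Definition left_brace (B : zmodType) (circ : B -> B -> B) : Prop :=
  is_group circ /\
  forall a b c : B, circ a (b + c) = circ a b - a + circ a c.

Definition lambda_map (B : zmodType) (circ : B -> B -> B) (a b : B) : B :=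
  - a + circ a b.

Definition ker_lambda (B : finZmodType) (circ : B -> B -> B) : {set B} :=
  [set a | [forall b, lambda_map circ a b == b]].

Definition additive_iso (A B : zmodType) : Prop :=
  exists2 f : A -> B, bijective f & {morph f : x y / x + y}.

Definition brace_iso (A B : zmodType)
    (circA : A -> A -> A) (circB : B -> B -> B) : Prop :=
  exists f : A -> B,
    [/\ bijective f, {morph f : x y / x + y} &
        forall x y : A, f (circA x y) = circB (f x) (f y)].

(* The exponents of g are elements of Z_q, read through their representatives
   in {0, ..., q - 1}; g has order q wherever this operation is used. *)
Definition brace_circ (p q : nat) (g : {unit 'F_p})
    (x y : 'F_p * 'F_p * 'F_q) : 'F_p * 'F_p * 'F_q :=
  let: (x1, x2, x3) := x in
  let: (y1, y2, y3) := y in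
  let half : 'F_q := 2%:R^-1 in
  (x1 + val g ^+ x3 * y1 + val g ^+ (half * x3)%R * x2 * y2,
   x2 + val g ^+ (half * x3)%R * y2,
   x3 + y3).

(* (T, op) is isomorphic to the group G_k = < s, t, e | ... >.  The presented
   group is finite, so \isog Grp does characterize it up to isomorphism. *)
Definition iso_calG (p q : nat) (g : {unit 'F_p}) (k : 'F_q)
    (T : Type) (op : T -> T -> T) : Prop :=
  exists (gT : finGroupType) (f : T -> gT),
    [/\ bijective f,
        forall x y : T, f (op x y) = (f x * f y)%g &
        ([set: gT] \isog Grp (s : t : e :
          (s ^+ p, t ^+ p, e ^+ q, [~ s, t],
           e * s * e^-1 = s ^+ (val g : 'F_p),
           e * t * e^-1 = t ^+ (val g ^+ k : 'F_p)%R)))%g].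

(* Main.v *)
(* If ker lambda has order p it is a lambda-invariant line L of the Sylow
   p-subgroup P of (B, +). Taking the first basis vector of P in L, lambda acts
   on P by upper triangular matrices and on the Sylow q-subgroup by scalars.
   Those scalars are characters of (B, o) with values in F_q^*, so they are
   trivial, as p > q makes p^2 q prime to q - 1; likewise p^2 is prime to p -
   1, so that P acts by unipotent matrices, with upper right entry c x2 (c <>
   0), since this entry is a homomorphism that vanishes on L. A generator of
   the q-part acts with diagonal (a, b); evaluating lambda on both sides of its
   commutation rule with P gives a = b^2, and b <> 1, since otherwise the
   generator, acting by a unipotent matrix of order dividing q, would lie in
   the kernel. So its action is diagonalizable, and rescaling the coordinates
   gives b = g^(1/2).

   For the presentation of G_2 one takes s = (1/2, 1, 0), t = (1, 0, 0) and e =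
   (0, 0, 2), so that s^n = (n^2/2, n, 0). *)
From HB Require Import structures.
Require Import Defs.
From mathcomp Require Import all_boot all_order all_algebra.
From mathcomp Require Import all_fingroup all_solvable.
From mathcomp Require Import finfield ring.

Set Implicit Arguments.
Unset Strict Implicit.
Unset Printing Implicit Defensive.

Import GRing.Theory.
Local Open Scope ring_scope.

(** * Exponents and multiples read modulo a prime *)

Lemma expr_FpD (R : pzSemiRingType) (r : nat) (u : R) (x y : 'F_r) :
  prime r -> u ^+ r = 1 -> u ^+ (x + y)%R = u ^+ x * u ^+ y.
Proof.
by move=> r_pr ur1; rewrite /= [X in (_ %% X)%N]Fp_cast // expr_mod // exprD.
Qed.

Lemma expr_FpM (R : pzSemiRingType) (r : nat) (u : R) (x y : 'F_r) :
  prime r -> u ^+ r = 1 -> u ^+ (x * y)%R = u ^+ x ^+ y.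
Proof.
by move=> r_pr ur1; rewrite /= [X in (_ %% X)%N]Fp_cast // expr_mod // exprM.
Qed.

Lemma expr_Fp_nat (R : pzSemiRingType) (r n : nat) (u : R) :
  prime r -> u ^+ r = 1 -> u ^+ (n%:R : 'F_r) = u ^+ n.
Proof. by move=> r_pr ur1; rewrite val_Fp_nat // expr_mod. Qed.

Lemma expg_FpD (gT : finGroupType) (r : nat) (u : gT) (x y : 'F_r) :
  prime r -> (u ^+ r = 1 -> u ^+ (x + y)%R = u ^+ x * u ^+ y)%g.
Proof.
by move=> r_pr ur1; rewrite /= [X in (_ %% X)%N]Fp_cast // expg_mod // expgD.
Qed.

Lemma expg_FpM (gT : finGroupType) (r : nat) (u : gT) (x y : 'F_r) :
  prime r -> (u ^+ r = 1 -> u ^+ (x * y)%R = u ^+ x ^+ y)%g.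
Proof.
by move=> r_pr ur1; rewrite /= [X in (_ %% X)%N]Fp_cast // expg_mod // expgM.
Qed.

Lemma mulrn_Fp (r : nat) (u x : 'F_r) : u *+ x = u * x.
Proof. by rewrite -mulr_natr natr_Zp. Qed.

Lemma mulrn_Fp_self (r : nat) (u : 'F_r) : prime r -> u *+ r = 0.
Proof. by move=> r_pr; rewrite -mulr_natr pchar_Fp_0 ?mulr0. Qed.

Lemma mulrn_Fp_eq0 (r n : nat) (u : 'F_r) :
  prime r -> coprime r n -> (u *+ n == 0) = (u == 0).
Proof.
move=> r_pr r_n; rewrite -mulr_natr mulf_eq0 -(dvdn_pcharf (pchar_Fp r_pr)).
by move: r_n; rewrite prime_coprime // => /negbTE ->; rewrite orbF.
Qed.

Lemma pair_mulrn (U V : zmodType) (u : U * V) (n : nat) :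
  u *+ n = (u.1 *+ n, u.2 *+ n).
Proof. by elim: n => [|n IH]; rewrite ?mulrS ?IH //; case: u {IH}. Qed.

(** By Fermat the order of [u] divides [r.-1], which is coprime to [n]; a Bezout relation
    concludes. *)
Lemma Fp_torsion_eq1 (r n : nat) (u : 'F_r) :
  prime r -> coprime n r.-1 -> u != 0 -> u ^+ n = 1 -> u = 1.
Proof.
move=> r_pr n_r u0 un; have ur: u ^+ r.-1 = 1.
  apply: (mulfI u0); rewrite -exprS prednK ?prime_gt0 // mulr1.
  by have:= expf_card u; rewrite card_Fp.
(* For [n = 0] coprimality forces [r.-1 = 1], and Fermat alone suffices. *)
case: (posnP n) => [n0|n_gt0].
  by move: n_r ur; rewrite n0 /coprime gcd0n => /eqP ->; rewrite expr1.
case: (egcdnP r.-1 n_gt0) => km kn eq_k _; move: n_r eq_k; rewrite /coprime => /eqP ->.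
move=> /(congr1 (fun i => u ^+ i)).
by rewrite mulnC exprM un expr1n exprD mulnC exprM ur expr1n mul1r expr1 => /esym.
Qed.

(** * Elementary properties of lambda in a left brace *)

Section LeftBrace.
Variables (B : zmodType) (circ : B -> B -> B).
Hypothesis circ_brace : left_brace circ.

Let lam := lambda_map circ.

Lemma circE a b : circ a b = a + lam a b.
Proof. by rewrite /lam /lambda_map addrA subrr add0r. Qed.

Lemma lambdaD a b c : lam a (b + c) = lam a b + lam a c.
Proof. by rewrite /lam /lambda_map circ_brace.2 !addrA. Qed.

Lemma lambda0 a : lam a 0 = 0.
Proof. by apply: (addrI (lam a 0)); rewrite -lambdaD !addr0. Qed.

Lemma circA : associative circ.
Proof. by case: circ_brace => -[]. Qed.

Lemma circr0 a : circ a 0 = a.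
Proof. by rewrite circE lambda0 addr0. Qed.

Lemma circ_unit0 e : left_id e circ -> e = 0.
Proof. by move=> e1; rewrite -[LHS]circr0 e1. Qed.

Lemma circ0r a : circ 0 a = a.
Proof.
by case: circ_brace => -[_ [e [e1 _ _]]] _; rewrite -(circ_unit0 e1) e1.
Qed.

Lemma circV a : exists b, circ b a = 0 /\ circ a b = 0.
Proof.
case: circ_brace => -[_ [e [e1 _ eV]]] _.
by have [b] := eV a; rewrite (circ_unit0 e1); exists b.
Qed.

Lemma lambda_id a : lam 0 a = a.
Proof. by rewrite -[RHS]circ0r circE add0r. Qed.

Lemma lambdaM a b c : lam (circ a b) c = lam a (lam b c).
Proof.
apply: (addrI (circ a b)); rewrite -circE -circA [circ b c]circE.
by rewrite circE lambdaD addrA -circE.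
Qed.

End LeftBrace.

(** * The finite group [(B, circ)] and the kernel of lambda. [circ_group] is a copy of [B] indexed
    by the brace axioms, from which its group structure is built *)

Definition circ_group (B : finZmodType) (circ : B -> B -> B)
  (circ_brace : left_brace circ) : Type := B.

Section CircGroup.
Variables (B : finZmodType) (circ : B -> B -> B).
Hypothesis circ_brace : left_brace circ.

(** The default [0] is never reached, by [circV]. *)
Let inv (a : B) : B := odflt 0 [pick b | circ b a == 0].

Lemma circ_invl : left_inverse 0 inv circ.
Proof.
move=> a; rewrite /inv; case: pickP => [b /eqP //|no_inv].
by have [b [/eqP ba _]] := circV circ_brace a; rewrite no_inv in ba.
Qed.

HB.instance Definition _ := Finite.on (circ_group circ_brace).
HB.instance Definition _ := Finite_isGroup.Build (circ_group circ_brace)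
  (circA circ_brace) (circ0r circ_brace) circ_invl.

Lemma ker_lambdaP a :
  reflect (lambda_map circ a =1 id) (a \in ker_lambda circ).
Proof. by rewrite inE; apply: (iffP forallP) => ka b; apply/eqP/ka. Qed.

(** For [k] in the kernel, [lambda_a(k)] is the conjugate of [k] by [a] for [circ], and kernels are
    normal. *)
Lemma ker_lambda_stable a k :
  k \in ker_lambda circ -> lambda_map circ a k \in ker_lambda circ.
Proof.
move/ker_lambdaP=> ker_k; have [b [_ ab]] := circV circ_brace a.
have -> : lambda_map circ a k = circ (circ a k) b.
  rewrite -(circA circ_brace) [circ k b](circE circ) ker_k.
  rewrite (circE circ) (lambdaD circ_brace) addrCA -(circE circ) ab.
  by rewrite addr0.
apply/ker_lambdaP => c; rewrite !lambdaM // ker_k -lambdaM // ab.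
exact: lambda_id.
Qed.

Lemma ker_lambda_mulrn k n :
  k \in ker_lambda circ -> k *+ n \in ker_lambda circ.
Proof.
move/ker_lambdaP=> ker_k; elim: n => [|n /ker_lambdaP IH].
  by apply/ker_lambdaP => c; rewrite mulr0n lambda_id.
apply/ker_lambdaP => c; have <- : circ k (k *+ n) = k *+ n.+1.
  by rewrite (circE circ) ker_k mulrS.
by rewrite lambdaM // IH ker_k.
Qed.

Lemma ker_lambda_group_set :
  group_set (ker_lambda circ : {set circ_group circ_brace}).
Proof.
apply/group_setP; split=> [|a b /ker_lambdaP ka /ker_lambdaP kb].
  by apply/ker_lambdaP=> c; apply: lambda_id.
by apply/ker_lambdaP=> c; rewrite lambdaM // kb ka.
Qed.

(** Additive multiples of a kernel element are its powers for [circ], so Lagrange applies to the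
    kernel as a subgroup of [(B, circ)]. *)
Lemma ker_lambda_mulrn_card k :
  k \in ker_lambda circ -> k *+ #|ker_lambda circ| = 0.
Proof.
move=> kk; have kX n : ((k : circ_group circ_brace) ^+ n)%g = k *+ n :> B.
  elim: n => // n IH; rewrite mulrS -IH expgS; move/ker_lambdaP: kk => kk.
  by rewrite -[X in k + X]kk -circE.
by rewrite -kX; apply: (@expg_cardG _ (group ker_lambda_group_set)).
Qed.

End CircGroup.

(** * Model braces: a q-th root of unity [b] plays the role of g^(1/2) *)

Definition std_circ (p q : nat) (b : 'F_p)
    (x y : 'F_p * 'F_p * 'F_q) : 'F_p * 'F_p * 'F_q :=
  (x.1.1 + (b ^+ x.2) ^+ 2 * y.1.1 + b ^+ x.2 * x.1.2 * y.1.2,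
   x.1.2 + b ^+ x.2 * y.1.2, x.2 + y.2).

Section TwoPrimes.
Variables p q : nat.
Hypotheses (p_prime : prime p) (q_prime : prime q) (q_lt_p : (q < p)%N).
Local Notation A := ('F_p * 'F_p * 'F_q)%type.

Let p_co_q : coprime p q.
Proof. by rewrite prime_coprime // gtnNdvd ?prime_gt0. Qed.

(** An additive map preserves p-torsion and q-torsion, so it is block diagonal; over a prime field
    additivity already gives linearity. *)
Lemma additive_coord (f : A -> A) (y : A) : {morph f : x y / x + y} ->
  f y = ((f (1, 0, 0)).1.1 * y.1.1 + (f (0, 1, 0)).1.1 * y.1.2,
         (f (1, 0, 0)).1.2 * y.1.1 + (f (0, 1, 0)).1.2 * y.1.2,
         (f (0, 0, 1)).2 * y.2).
Proof.
move=> fD; have f0 : f 0 = 0 by apply: (addrI (f 0)); rewrite -fD !addr0.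
have fMn x n : f (x *+ n) = f x *+ n.
  by elim: n => // n IH; rewrite !mulrS fD IH.
have mulnE (x : A) n : x *+ n = (x.1.1 *+ n, x.1.2 *+ n, x.2 *+ n).
  by rewrite !pair_mulrn.
have tors_p x : x *+ p = 0 -> (f x).2 = 0.
  move=> /(congr1 f); rewrite fMn f0 mulnE => -[_ _] /eqP.
  by rewrite mulrn_Fp_eq0 1?coprime_sym // => /eqP.
have tors_q x : x *+ q = 0 -> (f x).1 = 0.
  move=> /(congr1 f); rewrite fMn f0 mulnE => -[/eqP + /eqP + _].
  rewrite !mulrn_Fp_eq0 //.
  by case: (f x) => -[a b] c /= /eqP -> /eqP ->.
have yE : y = (1, 0, 0) *+ y.1.1 + (0, 1, 0) *+ y.1.2 + (0, 0, 1) *+ y.2.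
  case: y => -[a b] c; rewrite !mulnE /= !mulrn_Fp !mul0r !mul1r.
  by congr (_, _, _); rewrite /= ?(mul0rn, addr0, add0r).
rewrite [in LHS]yE !fD !fMn [f (1, 0, 0) *+ _]mulnE [f (0, 1, 0) *+ _]mulnE.
rewrite [f (0, 0, 1) *+ _]mulnE.
have [-> ->] : (f (1, 0, 0)).2 = 0 /\ (f (0, 1, 0)).2 = 0.
  by split; apply: tors_p; rewrite mulnE /= !(mul0rn, mulrn_Fp_self).
have -> : (f (0, 0, 1)).1 = 0.
  by apply: tors_q; rewrite mulnE /= !(mul0rn, mulrn_Fp_self).
by congr (_, _, _); rewrite /= !(mulrn_Fp, mul0rn, addr0, add0r).
Qed.

Lemma std_circ_brace (b : 'F_p) : b ^+ q = 1 -> left_brace (@std_circ p q b).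
Proof.
move=> bq; have bD := @expr_FpD _ q b _ _ q_prime bq.
have bV (z : 'F_q) : b ^+ (- z)%R * b ^+ z = 1.
  by rewrite -bD addNr.
have bV' (z : 'F_q) : b ^+ z * b ^+ (- z)%R = 1.
  by rewrite -bD addrN.
split; first split.
- move=> x y z; rewrite /std_circ bD; congr (_, _, _); rewrite /=; ring.
- exists 0; split=> [||[[x1 x2] x3]].
  + move=> [[x1 x2] x3]; rewrite /std_circ /= expr0.
    by congr (_, _, _); rewrite /=; ring.
  + by move=> [[x1 x2] x3]; rewrite /std_circ /=; congr (_, _, _); rewrite /=; ring.
  + have := bV x3; have := bV' x3.
    set c := b ^+ (- x3)%R; set d := b ^+ x3 => dc cd.
    (* Obtained by solving [x o y = 0] for the last coordinate, then the second, then the first. *)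
    exists (c ^+ 2 * (x2 ^+ 2 - x1), - (c * x2), - x3).
    split; rewrite /std_circ /= -/c -/d.
      by congr (_, _, _); rewrite ?addNr //; ring.
    congr (_, _, _); rewrite ?addrN //=; last by rewrite mulrN mulrA dc mul1r addrN.
    (* The identity isolates the factor [1 - d * c], which vanishes. *)
    have -> : x1 + d ^+ 2 * (c ^+ 2 * (x2 ^+ 2 - x1)) + d * x2 * - (c * x2)
            = (1 - d * c) * (x1 * (1 + d * c) - x2 ^+ 2 * (d * c)) by ring.
    by rewrite dc subrr mul0r.
- move=> x y z; rewrite /std_circ; congr (_, _, _); rewrite /=; ring.
Qed.

Lemma lambda_std_circ (b : 'F_p) (x y : A) :
  lambda_map (@std_circ p q b) x y =
    ((b ^+ x.2) ^+ 2 * y.1.1 + b ^+ x.2 * x.1.2 * y.1.2, b ^+ x.2 * y.1.2, y.2).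
Proof.
by rewrite /lambda_map /std_circ; congr (_, _, _); rewrite /= !addrA addNr add0r.
Qed.

Lemma expr_prime_eq1 (b : 'F_p) n :
  b ^+ q = 1 -> b != 1 -> b ^+ n = 1 -> (q %| n)%N.
Proof.
move=> bq b1 bn; rewrite -[(_ %| _)%N]negbK -prime_coprime //; apply: contra b1.
case: (egcdnP n (prime_gt0 q_prime)) => km kn eq_k _ /eqP qn.
move: (congr1 (GRing.exp b) eq_k); rewrite qn mulnC exprM bq expr1n exprD.
by rewrite mulnC exprM bn expr1n mul1r expr1 => ->.
Qed.

Lemma card_ker_std_circ (b : 'F_p) : b ^+ q = 1 -> b != 1 ->
  #|ker_lambda (@std_circ p q b)| = p.
Proof.
move=> bq b1.
have -> : ker_lambda (@std_circ p q b) = setX (setX setT [set 0]) [set 0].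
  apply/setP=> -[[x1 x2] x3]; rewrite !in_setX !in_set1 in_setT /=.
  apply/ker_lambdaP/andP=> [kx | [/eqP -> /eqP ->] -[[y1 y2] y3]].
    (* The image of the second basis vector gives [b ^+ x3 = 1] and then [x2 = 0]; since [b] has
       order [q] and [x3 < q], also [x3 = 0]. *)
    have := kx (0, 1, 0); rewrite lambda_std_circ => kxE.
    have:= congr1 (fun y => y.1.2) kxE; rewrite /= mulr1 => bx.
    have:= congr1 (fun y => y.1.1) kxE; rewrite /= bx mulr0 add0r mul1r mulr1 => ->.
    split=> //.
    have := expr_prime_eq1 bq b1 bx.
    have: (x3 < q)%N by rewrite -[X in (_ < X)%N](Fp_cast q_prime).
    rewrite -val_eqE /=; case: (val x3) => // n nq /(dvdn_leq (ltn0Sn _)).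
    by rewrite leqNgt nq.
  by rewrite lambda_std_circ /= expr0; congr (_, _, _); rewrite /=; ring.
by rewrite !cardsX !cards1 cardsT card_Fp // !muln1.
Qed.

(** Rescaling the ['F_q] coordinate by [k] turns [b] into [b ^+ k], so the choice among nontrivial
    q-th roots of unity is immaterial. *)
Lemma std_circ_exp_iso (b : 'F_p) (k : 'F_q) : b ^+ q = 1 -> k != 0 ->
  brace_iso (@std_circ p q (b ^+ k)) (@std_circ p q b).
Proof.
move=> bq k0; exists (fun x => (x.1, k * x.2)); split.
- by exists (fun x => (x.1, k^-1 * x.2)) => -[x1 x2] /=; rewrite (mulKf k0, mulVKf k0).
- by move=> [x1 x2] [y1 y2] /=; rewrite mulrDr.
- by move=> x y; rewrite /std_circ /= (expr_FpM k x.2 q_prime bq) mulrDr.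
Qed.

End TwoPrimes.

(** * Left braces whose kernel of lambda is the first coordinate axis *)

Section NormalizedKernel.
Variables p q : nat.
Hypotheses (p_prime : prime p) (q_prime : prime q) (q_lt_p : (q < p)%N).
Local Notation A := ('F_p * 'F_p * 'F_q)%type.
Variable circ : A -> A -> A.
Hypotheses (circ_brace : left_brace circ) (card_ker : #|ker_lambda circ| = p).
Hypothesis ker_e1 : (1, 0, 0) \in ker_lambda circ.

Let lam := lambda_map circ.
(** Matrix entries of [lam x]: on the p-part, [al] and [be] are diagonal and [ga] is the upper right
    entry; [chi] is the scalar on the q-part. *)
Let al x := (lam x (1, 0, 0)).1.1.
Let ga x := (lam x (0, 1, 0)).1.1.
Let be x := (lam x (0, 1, 0)).1.2.
Let chi x := (lam x (0, 0, 1)).2.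

(** The multiples of the first basis vector already give [p] elements of the kernel. *)
Lemma normalized_kerE x : (x \in ker_lambda circ) = (x.1.2 == 0) && (x.2 == 0).
Proof.
pose K := [set x : A | (x.1.2 == 0) && (x.2 == 0)].
suff <- : K = ker_lambda circ by rewrite inE.
apply/eqP; rewrite eqEcard card_ker; apply/andP; split.
  apply/subsetP=> -[[x1 x2] x3]; rewrite inE /= => /andP[/eqP -> /eqP ->].
  have <- : (1, 0, 0) *+ x1 = (x1, 0, 0) :> A.
    by rewrite !pair_mulrn /= !mul0rn natr_Zp.
  exact: ker_lambda_mulrn.
rewrite -[X in (X <= _)%N](card_Fp p_prime) -cardsT.
rewrite -(card_imset _ (_ : injective (fun x1 : 'F_p => (x1, 0, 0) : A))).
  by apply/subset_leq_card/subsetP=> _ /imsetP[x1 _ ->]; rewrite inE /= !eqxx.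
by move=> x1 y1 /(congr1 (fun x : A => x.1.1)).
Qed.

(** The lower left entry vanishes because the kernel is stable under lambda. *)
Let lamE x y :
  lam x y = (al x * y.1.1 + ga x * y.1.2, be x * y.1.2, chi x * y.2).
Proof.
rewrite [LHS](additive_coord p_prime q_prime q_lt_p); last exact: lambdaD.
have := ker_lambda_stable circ_brace x ker_e1; rewrite normalized_kerE -/lam.
by case/andP=> /eqP -> _; rewrite mul0r add0r.
Qed.

Let lamM x y z : lam (circ x y) z = lam x (lam y z).
Proof. exact: lambdaM. Qed.

Let alM x y : al (circ x y) = al x * al y.
Proof. by rewrite {1}/al lamM !lamE /= !(mulr0, mulr1, addr0). Qed.

Let beM x y : be (circ x y) = be x * be y.
Proof. by rewrite {1}/be lamM !lamE /= !(mulr0, mulr1, addr0). Qed.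

Let chiM x y : chi (circ x y) = chi x * chi y.
Proof. by rewrite {1}/chi lamM !lamE /= !(mulr0, mulr1, addr0). Qed.

Let gaM x y : ga (circ x y) = al x * ga y + ga x * be y.
Proof. by rewrite {1}/ga lamM !lamE /= !(mulr0, mulr1, addr0, add0r). Qed.

Let lam0 : [/\ al 0 = 1, be 0 = 1, chi 0 = 1 & ga 0 = 0].
Proof. by rewrite /al /be /chi /ga /lam !lambda_id. Qed.

Let character_trivial r (m : A -> 'F_r) (G : {group circ_group circ_brace}) :
  prime r -> coprime #|G| r.-1 -> m 0 = 1 ->
  (forall x y, m (circ x y) = m x * m y) -> forall x, x \in G -> m x = 1.
Proof.
move=> r_pr co m0 mM x Gx.
have mX n : m ((x : circ_group circ_brace) ^+ n)%g = m x ^+ n.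
  by elim: n => [|n IH]; rewrite ?m0 // expgS exprS -IH -mM.
have mx1 : m x ^+ #|G| = 1 by rewrite -mX (expg_cardG Gx) m0.
apply: (Fp_torsion_eq1 r_pr co) mx1.
(* The value [m x] is nonzero because [x] has an inverse for [circ]. *)
apply: contraTneq (oner_neq0 'F_r) => mx; have [y [_ xy]] := circV circ_brace x.
by rewrite -m0 -xy mM mx mul0r eqxx.
Qed.

Let chi1 x : chi x = 1.
Proof.
apply: (@character_trivial q chi [group of [set: circ_group circ_brace]]) => //.
- rewrite cardsT !card_prod !card_Fp // !coprimeMl.
  have pq : coprime p q.-1.
    rewrite prime_coprime // gtnNdvd ?(leq_ltn_trans (leq_pred _)) //.
    by rewrite -subn1 subn_gt0 prime_gt1.
  by rewrite pq -[q in coprime q](prednK (prime_gt0 q_prime)) coprimeSn.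
- by case: lam0.
Qed.

Let lambda_normalized x y : lam x y = (al x * y.1.1 + ga x * y.1.2, be x * y.1.2, y.2).
Proof. by rewrite lamE chi1 mul1r. Qed.

Let p_co_q : coprime p q.
Proof. by rewrite prime_coprime // gtnNdvd ?prime_gt0. Qed.

Let circ_normalized x y : circ x y = (x.1.1 + al x * y.1.1 + ga x * y.1.2,
  x.1.2 + be x * y.1.2, x.2 + y.2).
Proof. by rewrite circE -/lam lambda_normalized -addrA. Qed.

(** With [chi] trivial, the third coordinate is a homomorphism from [(A, circ)] to ['F_q]; this is
    its kernel, of order p^2. *)
Let sylow_p : {set circ_group circ_brace} := [set x : A | x.2 == 0].

Let sylow_group_set : group_set sylow_p.
Proof.
apply/group_setP; split=> [|x y]; first by rewrite inE.
by rewrite !inE [(x * y)%g]circ_normalized /= => /eqP -> /eqP ->; rewrite addr0.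
Qed.

Let card_sylow : #|sylow_p| = (p * p)%N.
Proof.
have -> : sylow_p = setX setT [set 0] by apply/setP=> -[a b]; rewrite !inE.
by rewrite cardsX cards1 cardsT card_prod card_Fp // muln1.
Qed.

Let sylow_al1 (x : A) : x.2 = 0 -> al x = 1 /\ be x = 1.
Proof.
have [al0 be0 _ _] := lam0.
have co : coprime #|sylow_p| p.-1.
  rewrite card_sylow coprimeMl.
  by rewrite -[p in coprime p](prednK (prime_gt0 p_prime)) coprimeSn.
move=> x3; have Px: x \in group sylow_group_set by rewrite inE x3.
by split; [apply: character_trivial Px | apply: character_trivial Px].
Qed.

Let c := ga (0, 1, 0).

Let ker_P (x : A) : lam x =1 id -> x.1.2 = 0 /\ x.2 = 0.
Proof. by move/ker_lambdaP; rewrite normalized_kerE => /andP[/eqP -> /eqP ->]. Qed.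

Let ga_ker (x1 : 'F_p) : ga (x1, 0, 0) = 0.
Proof.
suff /ker_lambdaP kx : (x1, 0, 0) \in ker_lambda circ by rewrite /ga /lam kx.
by rewrite normalized_kerE /= eqxx.
Qed.

(** Multiplying by the kernel element [(x1, 0, 0)] does not change lambda. *)
Let ga_snd (x1 x2 : 'F_p) : ga (x1, x2, 0) = ga (0, x2, 0).
Proof.
have [al1 be1] := @sylow_al1 (x1, 0, 0) erefl.
have -> : (x1, x2, 0) = circ (x1, 0, 0) (0, x2, 0).
  by rewrite circ_normalized be1 ga_ker /= !(mulr0, mul0r, mul1r, addr0, add0r).
by rewrite gaM al1 ga_ker mul0r addr0 mul1r.
Qed.

(** On the p-part the matrices are unipotent, so [ga] turns [circ] into addition; the first
    coordinate [c * n] that arises in the induction is invisible to [ga] by [ga_snd]. *)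
Let ga_sylow (x1 x2 : 'F_p) : ga (x1, x2, 0) = c * x2.
Proof.
rewrite ga_snd -[in LHS](natr_Zp x2) -mulrn_Fp; elim: (val x2) => [|n IH].
  exact: ga_ker.
have [al1 be1] := @sylow_al1 (0, 1, 0) erefl.
have [_ be2] := @sylow_al1 (0, n%:R, 0) erefl.
have E : circ (0, 1, 0) (0, n%:R, 0) = (c * n%:R, n.+1%:R, 0).
  by rewrite circ_normalized be1 al1 /= !(mulr0, mul1r, addr0, add0r) mulrS.
by rewrite -(ga_snd (c * n%:R)) -E gaM al1 be2 IH mul1r mulr1 mulrS addrC.
Qed.

Let c_neq0 : c != 0.
Proof.
apply/eqP=> c0; have [al1 be1] := @sylow_al1 (0, 1, 0) erefl.
case: (@ker_P (0, 1, 0)) => [|/eqP]; last by rewrite oner_eq0.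
by move=> -[[y1 y2] y3]; rewrite lambda_normalized al1 be1 -/c c0 /= mul0r !mul1r addr0.
Qed.

Let b := be (0, 0, 1).
Let d := ga (0, 0, 1).

Let circ_Q (y z : 'F_q) : circ (0, 0, y) (0, 0, z) = (0, 0, y + z).
Proof. by rewrite circ_normalized /= !mulr0 !addr0. Qed.

Let al_b : al (0, 0, 1) = b ^+ 2.
Proof.
(* The commutation rule. With [a] for [al (0, 0, 1)], the upper right entries of lambda on the two
   sides are [a * c + d] and [d + c * b ^+ 2]. *)
have E : circ (0, 0, 1) (0, 1, 0) = circ (d, b, 0) (0, 0, 1).
  by rewrite !circ_normalized /= !(mulr0, mulr1, addr0, add0r).
have [al1 be1] := @sylow_al1 (0, 1, 0) erefl.
have [al2 be2] := @sylow_al1 (d, b, 0) erefl.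
have := congr1 ga E; rewrite !gaM (ga_sylow d b) al2 be1 -/b -/c -/d mulr1 mul1r addrC.
by move/addrI; rewrite mulrC -mulrA => /(mulfI c_neq0).
Qed.

Let be_Q (n : nat) : be (0, 0, n%:R) = b ^+ n.
Proof.
elim: n => [|n IH]; first by case: lam0.
by rewrite exprS -IH -beM circ_Q mulrS.
Qed.

Let al_Q (n : nat) : al (0, 0, n%:R) = (b ^+ n) ^+ 2.
Proof.
elim: n => [|n IH]; first by rewrite expr1n; case: lam0.
by rewrite [b ^+ _]exprS exprMn -IH -al_b -alM circ_Q mulrS.
Qed.

Let b_q : b ^+ q = 1.
Proof. by rewrite -be_Q pchar_Fp_0 //; case: lam0. Qed.

Let b_neq0 : b != 0.
Proof.
apply: contra_eq_neq b_q => ->.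
by rewrite expr0n gtn_eqF ?prime_gt0 // eq_sym oner_eq0.
Qed.

(** If [b = 1], then [ga (0, 0, n%:R)] is [d *+ n]; taking [n = q] gives [d = 0], which puts
    [(0, 0, 1)] in the kernel. *)
Let b_neq1 : b != 1.
Proof.
apply/eqP=> b1; have ga_Q n : ga (0, 0, n%:R) = d *+ n.
  elim: n => [|n IH]; first by case: lam0.
  rewrite [in LHS]mulrS -circ_Q gaM IH al_b be_Q -/b b1 !expr1n mul1r mulr1.
  by rewrite -/d mulrSr.
have d0 : d = 0.
  apply/eqP; rewrite -(mulrn_Fp_eq0 d p_prime p_co_q) -ga_Q pchar_Fp_0 //.
  by case: lam0 => _ _ _ ->.
case: (@ker_P (0, 0, 1)) => [|_ /eqP]; last by rewrite oner_eq0.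
move=> -[[y1 y2] y3]; rewrite lambda_normalized al_b -/b -/d d0 b1 /= mul0r expr1n.
by rewrite !mul1r addr0.
Qed.

(* [(s, 1)] is the eigenvector of the action of (0, 0, 1) on the Sylow
   p-subgroup for the eigenvalue [b]. *)
Let s := d / (b - b ^+ 2).

(** The diagonal is [(b ^+ n) ^+ 2], [b ^+ n], and [(s, 1)] stays an eigenvector for [b ^+ n]; this
    determines the upper right entry. *)
Let ga_Q (n : nat) : ga (0, 0, n%:R) = s * (b ^+ n - (b ^+ n) ^+ 2).
Proof.
elim: n => [|n IH]; first by case: lam0 => _ _ _ ->; rewrite expr1n subrr mulr0.
have dE : d = s * (b - b ^+ 2).
  rewrite divfK // expr2 -[X in X - _]mulr1 -mulrBr mulf_neq0 //.
  by rewrite subr_eq0 eq_sym.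
rewrite [in LHS]mulrS -circ_Q gaM IH al_b be_Q -/d dE [b ^+ n.+1]exprS.
by ring.
Qed.

Lemma normalized_ker_std_circ :
  exists2 b : 'F_p, b ^+ q = 1 /\ b != 1 & brace_iso circ (@std_circ p q b).
Proof.
(* Coordinates of the p-part in the basis [(c, 0)], [(s, 1)]: the eigenvector diagonalizes the
   action of the q-part, and the factor [c] normalizes the unipotent entry. *)
exists b => //; exists (fun x => ((x.1.1 - s * x.1.2) / c, x.1.2, x.2)); split.
- exists (fun x => (c * x.1.1 + s * x.1.2, x.1.2, x.2)) => -[[x1 x2] x3] /=.
    by rewrite mulrC divfK // subrK.
  by rewrite addrK mulrC mulKf.
- by move=> x y; congr (_, _, _) => //=; rewrite -mulrDl mulrDr opprD addrACA.
move=> x y; pose z := x.2.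
have zE : (0, 0, z) = (0, 0, (z : nat)%:R) by rewrite natr_Zp.
(* Splitting [x] into a p-part and a q-part reduces its matrix to the two cases already computed. *)
have xE : x = circ (x.1, 0) (0, 0, z).
  by rewrite circ_normalized /= !mulr0 !addr0 add0r -!surjective_pairing.
have [al1 be1] := @sylow_al1 (x.1, 0) erefl.
have alx : al x = (b ^+ z) ^+ 2 by rewrite xE alM al1 mul1r zE al_Q.
have bex : be x = b ^+ z by rewrite xE beM be1 mul1r zE be_Q.
have gax : ga x = s * (b ^+ z - (b ^+ z) ^+ 2) + c * x.1.2 * b ^+ z.
  rewrite {1}xE gaM al1 mul1r zE ga_Q be_Q; congr (_ + _ * _).
  by case: (x.1) => x1 x2; apply: ga_sylow.
rewrite circ_normalized /std_circ /= alx bex gax -/z; congr (_, _, _).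
by field; rewrite c_neq0.
Qed.

End NormalizedKernel.

(** * Transport along brace isomorphisms *)

Section BraceIso.
Variables (A B : finZmodType) (circA : A -> A -> A) (circB : B -> B -> B).
Hypothesis isoAB : brace_iso circA circB.

Lemma brace_iso_sym : brace_iso circB circA.
Proof.
have [f [[h fK hK] fD fM]] := isoAB; exists h; split; first by exists f.
- by move=> x y; apply: (can_inj fK); rewrite fD !hK.
- by move=> x y; apply: (can_inj fK); rewrite fM !hK.
Qed.

Lemma brace_iso_trans (C : zmodType) (circC : C -> C -> C) :
  brace_iso circB circC -> brace_iso circA circC.
Proof.
have [f [f_bij fD fM]] := isoAB; move=> [h [h_bij hD hM]].
exists (h \o f); split=> [|x y|x y] /=; first exact: bij_comp.
  by rewrite fD hD.
by rewrite fM hM.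
Qed.

Lemma brace_iso_left_brace : left_brace circA -> left_brace circB.
Proof.
have [f [[h fK hK] fD fM]] := isoAB => -[[cA [e [e1 e2 eV]]] cD].
have fN x : f (- x) = - f x.
  have f0 : f 0 = 0 by apply: (addrI (f 0)); rewrite -fD !addr0.
  by apply: (addrI (f x)); rewrite -fD !subrr f0.
split; first split.
- by move=> x y z; rewrite -(hK x) -(hK y) -(hK z) -!fM cA.
- exists (f e); split=> [x|x|x]; first by rewrite -(hK x) -fM e1.
    by rewrite -(hK x) -fM e2.
  by have [y [yx xy]] := eV (h x); exists (f y); rewrite -(hK x) -!fM yx xy.
- by move=> x y z; rewrite -(hK x) -(hK y) -(hK z) -!(fD, fM) -fN -!fD cD.
Qed.

Lemma brace_iso_card_ker : #|ker_lambda circA| = #|ker_lambda circB|.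
Proof.
have [f [[h fK hK] fD fM]] := isoAB; rewrite -(card_imset _ (can_inj fK)).
have lamf a b : lambda_map circB (f a) (f b) = f (lambda_map circA a b).
  by apply: (addrI (f a)); rewrite -circE -fM -fD -circE.
apply: eq_card => x; rewrite -{}(hK x) mem_imset; last exact: can_inj fK.
apply/ker_lambdaP/ker_lambdaP => kx y; first by rewrite -(hK y) lamf kx.
by apply: (can_inj fK); rewrite -lamf kx.
Qed.

Lemma brace_iso_iso_calG p q (g : {unit 'F_p}) (k : 'F_q) :
  iso_calG g k circB -> iso_calG g k circA.
Proof.
have [f [f_bij _ fM]] := isoAB => -[gT [h [h_bij hM G]]].
by exists gT, (h \o f); split=> // [|x y]; [apply: bij_comp | rewrite /= fM hM].
Qed.

End BraceIso.

(** * Reduction of an arbitrary left brace to the normalized kernel *)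

Lemma det2_bijective (F : fieldType) (u u' v v' : F) :
  u * v' - u' * v != 0 ->
  bijective (fun x : F * F => (u * x.1 + u' * x.2, v * x.1 + v' * x.2)).
Proof.
(* Cramer's rule. *)
move=> D0; exists (fun x : F * F => ((v' * x.1 - u' * x.2) / (u * v' - u' * v),
  (u * x.2 - v * x.1) / (u * v' - u' * v))) => -[x1 x2];
  by congr (_, _) => /=; field.
Qed.

Lemma left_brace_uniqueness (p q : nat) (B : finZmodType) (circ : B -> B -> B) :
    prime p -> prime q -> (q < p)%N -> left_brace circ ->
    additive_iso B ('F_p * 'F_p * 'F_q)%type -> #|ker_lambda circ| = p ->
  exists2 b : 'F_p, b ^+ q = 1 /\ b != 1 & brace_iso circ (@std_circ p q b).
Proof.
move=> p_pr q_pr q_lt_p circ_brace [f [h fK hK] fD] card_ker.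
have f0 : f 0 = 0 by apply: (addrI (f 0)); rewrite -fD !addr0.
have [k ker_k k0] : exists2 k, k \in ker_lambda circ & k != 0.
  apply/exists_inP; rewrite -[[exists _ in _, _]]negbK negb_exists_in.
  apply: contraTN (prime_gt1 p_pr) => /forall_inP ker0.
  rewrite -leqNgt -card_ker -(cards1 (0 : B)) subset_leq_card //.
  by apply/subsetP=> k /ker0; rewrite inE negbK.
(* The kernel has order [p], so [k] is p-torsion and has no q-component. *)
have fk2 : (f k).2 = 0.
  have fMn n : f (k *+ n) = f k *+ n by elim: n => // n IH; rewrite !mulrS fD IH.
  have := fMn p; rewrite -[in k *+ p]card_ker.
  rewrite (ker_lambda_mulrn_card circ_brace) // f0.
  rewrite pair_mulrn => /(congr1 snd) /= /esym/eqP.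
  rewrite mulrn_Fp_eq0 // => [/eqP //|].
  by rewrite coprime_sym prime_coprime // gtnNdvd ?prime_gt0.
set u := (f k).1.1; set v := (f k).1.2.
(* The nonzero vector [(u, v)] is completed to a basis of the plane. *)
have [u' [v' D0]] : exists u' v', u * v' - u' * v != 0.
  have [u0|u0] := eqVneq u 0; last by exists 0, 1; rewrite mul0r subr0 mulr1.
  exists 1, 0; rewrite mulr0 mul1r add0r oppr_eq0; apply: contraNneq k0 => v0.
  rewrite -(can_eq fK) f0 -/u; move: u0 v0 fk2; rewrite /u /v.
  by case: (f k) => -[? ?] ? /= -> -> ->.
pose phi (x : 'F_p * 'F_p * 'F_q) : 'F_p * 'F_p * 'F_q :=
  (u * x.1.1 + u' * x.1.2, v * x.1.1 + v' * x.1.2, x.2).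
have [psi phiK psiK] : bijective phi.
  have [h2 h2K K2h] := det2_bijective D0.
  exists (fun x => (h2 x.1, x.2)) => -[x1 x2] /=; first by rewrite /phi h2K.
  by have := K2h x1; rewrite /phi /= => ->.
have phiD : {morph phi : x y / x + y}.
  by move=> x y; congr (_, _, _) => //=; rewrite !mulrDr addrACA.
have psiD : {morph psi : x y / x + y}.
  by move=> x y; apply: (can_inj phiK); rewrite phiD !psiK.
(* The operation transported to coordinates in which [k] becomes [(1, 0, 0)]. *)
pose circ' x y := psi (f (circ (h (phi x)) (h (phi y)))).
have iso : brace_iso circ circ'.
  exists (psi \o f); split=> [|x y|x y].
  - by exists (h \o phi); [apply: can_comp | apply: can_comp].
  - by rewrite /= fD psiD.
  - by rewrite /= /circ' !psiK !fK.
have card_ker' : #|ker_lambda circ'| = p by rewrite -(brace_iso_card_ker iso).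
have ker_e1 : (1, 0, 0) \in ker_lambda circ'.
  apply/ker_lambdaP => y.
  have phi1 : phi (1, 0, 0) = f k.
    rewrite /phi /= !mulr1 !mulr0 !addr0 -fk2 /u /v; by case: (f k) => -[].
  rewrite /lambda_map /circ' phi1 fK (circE circ); move/ker_lambdaP: ker_k => ->.
  by rewrite fD psiD hK phiK -phi1 phiK addrA addNr add0r.
have circ'_brace := brace_iso_left_brace iso circ_brace.
have [b b_root iso'] :=
  normalized_ker_std_circ p_pr q_pr q_lt_p circ'_brace card_ker' ker_e1.
by exists b => //; exact: (brace_iso_trans iso iso').
Qed.

(** * The multiplicative group and the presentation of G_2 *)

Section Presentation.
Variables p q : nat.
Hypotheses (p_prime : prime p) (q_prime : prime q) (p_gt2 : (2 < p)%N).
Hypothesis q_gt2 : (2 < q)%N.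
Local Notation A := ('F_p * 'F_p * 'F_q)%type.
Variables (g : {unit 'F_p}) (b : 'F_p).
Hypotheses (b_q : b ^+ q = 1) (b2 : b ^+ 2 = val g).

Let two_neq0 r : prime r -> (2 < r)%N -> 2%:R != 0 :> 'F_r.
Proof.
move=> r_pr r_gt2; rewrite mulrn_Fp_eq0 ?oner_eq0 //.
by rewrite prime_coprime // gtnNdvd.
Qed.

Let twop := two_neq0 p_prime p_gt2.
Let twoq := two_neq0 q_prime q_gt2.

(** Conjugation by [e] multiplies exponents of [u] by [r]. This form moves powers of [e] to the
    right when words are put in normal form. *)
Lemma expg_conj_Fp (gT : finGroupType) (u e : gT) (r n : 'F_p) (m : nat) :
    (u ^+ p = 1 -> e * u * e^-1 = u ^+ r ->
  e ^+ m * u ^+ n = u ^+ (r ^+ m * n)%R * e ^+ m)%g.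
Proof.
move=> up eu; have eu1 (k : 'F_p) : (e * u ^+ k = u ^+ (r * k)%R * e)%g.
  apply: (canRL (mulgKV _)); rewrite expg_FpM // -eu.
  have eJ x : (e * x * e^-1 = x ^ e^-1)%g by rewrite conjgE invgK mulgA.
  by rewrite !eJ conjXg.
elim: m => [|m IH]; first by rewrite expr0 mul1r mulg1 mul1g.
by rewrite expgS -mulgA IH mulgA eu1 -mulgA -expgS mulrA -exprS.
Qed.

Lemma std_circ_iso_calG : iso_calG g (2%:R : 'F_q) (@std_circ p q b).
Proof.
pose gT : finGroupType := circ_group (std_circ_brace q_prime b_q).
exists gT, id; split=> //; first by exists id.
have g2 : val g ^+ (2%:R : 'F_q) = val g ^+ 2.
  by rewrite val_Fp_nat // modn_small.
have mulE (x y : gT) : (x * y)%g = std_circ b x y by [].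
(* Conjugation by [e] multiplies the second coordinate by [b ^+ 2], that is g, and the first by g^2,
   which sends [s] to s^g and [t] to t^(g^2). *)
pose s : gT := (2%:R^-1, 1, 0); pose t : gT := (1, 0, 0).
pose e : gT := (0, 0, 2%:R).
have sX n : (s ^+ n)%g = (n%:R ^+ 2 / 2%:R, n%:R, 0) :> A.
  elim: n => [|n IH]; first by rewrite expr0n mul0r.
  rewrite expgS mulE IH /std_circ /s /=; congr (_, _, _) => /=.
  - by rewrite mulrS; field.
  - by rewrite !mul1r mulrS.
  - by rewrite addr0.
have tX n : (t ^+ n)%g = (n%:R, 0, 0) :> A.
  elim: n => [//|n IH].
  rewrite expgS mulE IH /std_circ /t /=; congr (_, _, _) => /=.
  - by rewrite expr1n !mulr0 mul1r addr0 mulrS.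
  - by rewrite mulr0 addr0.
  - by rewrite addr0.
have eX n : (e ^+ n)%g = (0, 0, 2%:R * n%:R) :> A.
  elim: n => [|n IH]; first by rewrite mulr0.
  rewrite expgS mulE IH /std_circ /e /=; congr (_, _, _) => /=.
  - by rewrite !mulr0 !addr0.
  - by rewrite mulr0 addr0.
  - by rewrite [1 *+ n.+1]mulrS mulrDr mulr1.
have be2 : b ^+ (2%:R : 'F_q) = val g by rewrite expr_Fp_nat.
(* The subtracted term compensates the first coordinate of the power of [s]. *)
have decE (x : gT) : x = (t ^+ (x.1.1 - x.1.2 ^+ 2 / 2%:R : 'F_p)%R
    * s ^+ (x.1.2 : 'F_p) * e ^+ (x.2 / 2%:R : 'F_q)%R)%g.
  rewrite !mulE tX sX eX !natr_Zp /std_circ /=.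
  rewrite expr0 !mulr0 !addr0 !add0r !mul1r [2%:R * _]mulrC divfK //.
  by rewrite expr1n mul1r subrK mul0r addr0 -!surjective_pairing.
have sp : (s ^+ p)%g = 1%g by rewrite [LHS]sX pchar_Fp_0 // expr0n mul0r.
have tp : (t ^+ p)%g = 1%g by rewrite [LHS]tX pchar_Fp_0.
have eq : (e ^+ q)%g = 1%g by rewrite [LHS]eX pchar_Fp_0 // mulr0.
have st : [~ s, t]%g = 1%g.
  apply/eqP/commgP; rewrite /commute !mulE /std_circ; congr (_, _, _) => /=; ring.
have es : (e * s * e^-1 = s ^+ (val g : 'F_p))%g.
  apply: (canLR (mulgK _)); rewrite !mulE sX natr_Zp /std_circ /= be2.
  by congr (_, _, _) => /=; [field | ring | rewrite addr0 add0r].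
have et : (e * t * e^-1 = t ^+ (val g ^+ 2 : 'F_p)%R)%g.
  apply: (canLR (mulgK _)); rewrite !mulE tX natr_Zp /std_circ /= be2.
  by congr (_, _, _) => /=; [ring | ring | rewrite addr0 add0r].
have gen : (<[s]> <*> <[t]> <*> <[e]>)%g = [set: gT].
  apply/eqP; rewrite -subTset; apply/subsetP=> x _; rewrite [x]decE.
  have := subxx (<[s]> <*> <[t]> <*> <[e]>)%g.
  rewrite {1}join_subG {1}join_subG !cycle_subG => /andP[/andP[Ss St] Se].
  by rewrite !groupM ?groupX.
(* First the relations are checked in [gT]; then every group satisfying them is shown to be a
   homomorphic image of [gT]. *)
apply: intro_isoGrp => [|rT H].
  apply/existsP; exists (s, t, e) => /=.
  by rewrite g2 gen sp tp eq st es et.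
case/existsP=> -[[s' t'] e'] /= /eqP[defH s'p t'p e'q s't' e's' e't'].
rewrite g2 in e't'.
pose word (k n : 'F_p) (w : 'F_q) := (t' ^+ k * s' ^+ n * e' ^+ w)%g.
have wordM (k n k' n' : 'F_p) (w w' : 'F_q) :
  (word k n w * word k' n' w')%g =
  word (k + (val g ^+ w) ^+ 2 * k') (n + val g ^+ w * n') (w + w').
  have tw := expg_conj_Fp k' w t'p e't'.
  have sw := expg_conj_Fp n' w s'p e's'.
  have ts i j : commute (t' ^+ i)%g (s' ^+ j)%g.
    by apply/commuteX2/commute_sym/commgP/eqP.
  rewrite /word !expg_FpD // -exprM mulnC exprM.
  rewrite -!mulgA; congr (_ * _)%g; rewrite [in RHS]mulgA [in RHS]ts -!mulgA.
  congr (_ * _)%g; rewrite mulgA tw -!mulgA; congr (_ * _)%g.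
  by rewrite mulgA sw -!mulgA.
(* The decomposition [decE], read in the generators of [H]. *)
pose phi (x : gT) := word (x.1.1 - x.1.2 ^+ 2 / 2%:R) x.1.2 (x.2 / 2%:R).
have phiM : {in [set: gT] &, {morph phi : x y / (x * y)%g}}.
  move=> x y _ _; rewrite /phi wordM.
  have <- : b ^+ x.2 = val g ^+ (x.2 / 2%:R)%R.
    by rewrite -be2 -expr_FpM // mulrC divfK.
  congr word; rewrite mulE /std_circ /=; last by rewrite mulrDl.
  by field.
have expg1F r (u : rT) : prime r -> (u ^+ (1%R : 'F_r) = u)%g.
  by move=> r_pr; rewrite -[1%R]/(1%:R)%R val_Fp_nat // modn_small ?prime_gt1.
have phi_s : phi s = s'.
  rewrite /phi /word /s expr1n mul1r subrr mul0r !expg0 /= (expg1F p) // mulg1.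
  exact: mul1g.
have phi_t : phi t = t'.
  rewrite /phi /word /t expr0n mul0r subr0 mul0r !expg0 !mulg1 /=.
  exact: (expg1F _ _ p_prime).
have phi_e : phi e = e'.
  rewrite /phi /word /e expr0n mul0r subr0 divff // !expg0 !mul1g.
  exact: (expg1F _ _ q_prime).
have im_phi x : phi x \in (Morphism phiM @* [set: gT])%g by apply: mem_morphim.
apply/homgP; exists (Morphism phiM); apply/eqP; rewrite eqEsubset.
rewrite -{2}defH !join_subG !cycle_subG.
apply/andP; split; last first.
  by rewrite -phi_s -phi_t -phi_e !im_phi.
have := subxx H; rewrite -{1}defH !join_subG !cycle_subG => /andP[/andP[Hs Ht] He].
by apply/subsetP=> _ /morphimP[x _ _ ->]; rewrite !groupM ?groupX.
Qed.
End Presentation.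

(** * Roots of unity and the comparison with [brace_circ] *)

Lemma expr_prime_root_inv (p q : nat) (b u : 'F_p) : prime q ->
  b ^+ q = 1 -> b != 1 -> u ^+ q = 1 -> exists k : 'F_q, u = b ^+ k.
Proof.
move=> q_pr bq b1 uq; have [m bm] := prim_order_exists (prime_gt0 q_pr) bq.
have m1 : m != 1%N.
  by apply: contraNneq b1 => m1; rewrite -[b]expr1 -m1 prim_expr_order.
move/(prime_nt_dvdP q_pr m1) => m_eq.
rewrite m_eq in bm; have [i ->] := prim_rootP bm uq.
by exists (i%:R); rewrite expr_Fp_nat.
Qed.

(** The root is g^(1/2), with 1/2 computed in ['F_q]; it squares to g because [q] is odd and g^q =
    1. *)
Lemma brace_circ_std_circ (p q : nat) (g : {unit 'F_p}) : prime q -> (2 < q)%N ->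
    val g ^+ q = 1 ->
  exists b : 'F_p, [/\ b ^+ q = 1, b ^+ 2 = val g &
    @brace_circ p q g =2 @std_circ p q b].
Proof.
move=> q_pr q_gt2 gq; pose half : 'F_q := 2%:R^-1.
have two0 : 2%:R != 0 :> 'F_q.
  by rewrite mulrn_Fp_eq0 ?oner_eq0 // prime_coprime // gtnNdvd.
have bq : (val g ^+ half) ^+ q = 1 by rewrite exprAC gq expr1n.
have b2 : (val g ^+ half) ^+ 2 = val g.
  by rewrite -(expr_Fp_nat 2 q_pr bq) -expr_FpM // mulVf // (expr_Fp_nat 1).
exists (val g ^+ half); split=> // -[[x1 x2] x3] [[y1 y2] y3].
have gx : val g ^+ x3 = ((val g ^+ half) ^+ x3) ^+ 2.
  by rewrite -[in LHS]b2 exprAC.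
by rewrite /brace_circ /std_circ -/half expr_FpM // gx.
Qed.

Local Close Scope ring_scope.

Theorem proposition3p8 (p q : nat) (p_prime : prime p) (q_prime : prime q)
    (p_mod_q : p = 1 %[mod q]) (q_gt2 : 2 < q)
    (g : {unit 'F_p}) (g_order : #[g]%g = q) :
  [/\ left_brace (@brace_circ p q g) /\
        #|ker_lambda (@brace_circ p q g)| = p,
      forall (B : finZmodType) (circ : B -> B -> B),
        left_brace circ ->
        additive_iso B ('F_p * 'F_p * 'F_q)%type ->
        #|ker_lambda circ| = p ->
        brace_iso circ (@brace_circ p q g) &
      iso_calG g (2%:R : 'F_q)%R (@brace_circ p q g)].
Proof.
have q_lt_p : q < p.
  have q_dvd : q %| p - 1 by rewrite -eqn_mod_dvd ?prime_gt0 //; apply/eqP.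
  by rewrite -[p]prednK ?prime_gt0 // ltnS -subn1 dvdn_leq // subn_gt0 prime_gt1.
have gq : (val g ^+ q = 1)%R by rewrite -FinRing.val_unitX -g_order expg_order.
have [b [bq b2 gb]] := brace_circ_std_circ q_prime q_gt2 gq.
have b1 : b != 1%R.
  apply/eqP=> b1; move: q_gt2; rewrite -g_order.
  suff -> : g = 1%g by rewrite order1.
  by apply: val_inj; rewrite -b2 b1 expr1n.
have iso_b : brace_iso (@std_circ p q b) (@brace_circ p q g).
  by exists id; split=> //; exists id.
split.
- by rewrite -(brace_iso_card_ker iso_b) card_ker_std_circ //; split=> //;
    apply: brace_iso_left_brace iso_b (std_circ_brace _ _).
- move=> B circ circ_brace addB card_ker.
  have [u [uq u1] iso_u] :=
    left_brace_uniqueness p_prime q_prime q_lt_p circ_brace addB card_ker.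
  (* The root [u] obtained from [circ] is a power of the fixed root [b], with nonzero exponent as
     [u != 1]; rescaling the last coordinate then identifies the two models. *)
  have [k uk] := expr_prime_root_inv q_prime bq b1 uq.
  have k0 : k != 0%R by apply: contraNneq u1 => k0; rewrite uk k0 expr0.
  apply: (brace_iso_trans iso_u); apply: brace_iso_trans iso_b.
  by rewrite uk; apply: std_circ_exp_iso.
- have p_gt2 := ltn_trans q_gt2 q_lt_p.
  have calG := std_circ_iso_calG p_prime q_prime p_gt2 q_gt2 bq b2.
  exact: (brace_iso_iso_calG (brace_iso_sym iso_b) calG).
Qed.
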